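(* Let $(\varOmega,\mathfrak{A},\mathbb{P})$ be a complete probability space, let $\mathbb{X}\subset\mathbb{R}^n$ be a Borel set, let $X$ be a random set (the prior), and let $X^d$ be the measurement induced random set $X^d(\omega)=\{y\in\mathbb{X}\mid h(y)+\epsilon(\omega)\in\mathcal{Z}\}$, where $h$ is the computational model defined on $\mathbb{X}$, $\epsilon(\omega)$ is a random variable (the measurement noise) and $\mathcal{Z}$ is the observed set. Assume that $X$ and $X^d$ are integrally bounded random sets, that $X$ and $X^d$ are independent, and that $$0<\int_{\mathbb{X}}\int_{\varOmega}\mathbf{1}_{X(\omega)}(y)\,\mathbb{P}(\mathrm{d}\omega)\,\mathrm{d}y<\infty .$$ Let $X^a(\omega)=X(\omega)\cap X^d(\omega)$ be the posterior random set, let $K=1-\int_{\varOmega}\mathbf{1}(X^a(\omega)\neq\emptyset)\,\mathbb{P}(\mathrm{d}\omega)$, assume $K<1$, and let $$\mathbb{P}^a(\mathrm{d}\omega)=\frac{\mathbf{1}(X^a(\omega)\neq\emptyset)\,\mathbb{P}(\mathrm{d}\omega)}{1-K}.$$ Assume that $X=\mathrm{cl}(\mathrm{int}\,X)$, $X^d=\mathrm{cl}(\mathrm{int}\,X^d)$ and $X^a=\mathrm{cl}(\mathrm{int}\,X^a)$ almost surely. Let $\pi_T$ be the capacity transform pdf of $X$ (with respect to $\mathbb{P}$) and $\pi_T^a$ the capacity transform pdf of $X^a$ (with respect to $\mathbb{P}^a$). Then $\pi_T^a$ is the posterior pdf obtained by Bayesian inference with prior pdf $\pi_T$ and likelihood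 function $\mathcal{L}(y)=\int_{\varOmega}\mathbf{1}_{X^d(\omega)}(y)\,\mathbb{P}(\mathrm{d}\omega)$, that is, for $y\in\mathbb{X}$, $$\pi_T^a(y)=\frac{\pi_T(y)\,\mathcal{L}(y)}{\int_{\mathbb{X}}\pi_T(y')\,\mathcal{L}(y')\,\mathrm{d}y'} .$$
   Context: A random set is a measurable map $X:\varOmega\to\mathfrak{X}$, where $\mathfrak{X}$ is the family of (relatively) closed subsets of $\mathbb{X}$; measurability means $\{\omega\mid X(\omega)\cap G\neq\emptyset\}\in\mathfrak{A}$ for every relatively open $G\subset\mathbb{X}$, and independence of random sets is with respect to the $\sigma$-algebra on $\mathfrak{X}$ generated by the families $\{F\in\mathfrak{X}\mid F\cap G\neq\emptyset\}$. A random set $X$ is integrally bounded if $\mathbb{E}\bigl(\sup_{y\in X(\omega)}\|y\|\bigr)<\infty$ (with supremum $0$ over the empty set). $\mathrm{int}$ denotes the interior in $\mathbb{R}^n$ and $\mathrm{cl}$ the closure in $\mathbb{X}$. $\mathbf{1}(\cdot)$ equals $1$ if the condition in brackets is true and $0$ otherwise, and $\mathbf{1}_{\mathcal{X}}(y)=\mathbf{1}(y\in\mathcal{X})$. The capacity transform pdf of a random set $Y$ with respect to a probability measure $\mathbb{Q}$ on $(\varOmega,\mathfrak{A})$ is $$y\mapsto\frac{\int_{\varOmega}\mathbf{1}_{Y(\omega)}(y)\,\mathbb{Q}(\mathrm{d}\omega)}{\int_{\mathbb{X}}\int_{\varOmega}\mathbf{1}_{Y(\omega)}(y')\,\mathbb{Q}(\mathrm{d}\omega)\,\mathrm{d}y'}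 ,$$ which is well-defined when the denominator lies in $(0,\infty)$; here $\mathrm{d}y'$ is Lebesgue measure. *)

(* Defs.v *)
From HB Require Import structures.
From mathcomp Require Import all_boot all_order all_algebra.
From mathcomp Require Import all_classical all_reals all_analysis measurable_realfun.

Set Implicit Arguments.
Unset Strict Implicit.
Unset Printing Implicit Defensive.

Import Order.TTheory GRing.Theory Num.Theory.
Import numFieldNormedType.Exports.

Local Open Scope classical_set_scope.
Local Open Scope ring_scope.
Local Open Scope ereal_scope.

(* Row vectors with the Borel sigma-algebra of their product topology. *)
Definition borel_rV (R : realType) (n : nat) : Type :=
  g_sigma_algebraType (@open 'rV[R]_n).

HB.instance Definition _ (R : realType) (n : nat) :=
  Measurable.on (borel_rV R n).

Definition cons_rV (R : realType) (n : nat) (p : R * borel_rV R n) :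
  borel_rV R n.+1 := row_mx (const_mx p.1 : 'rV[R]_1) (p.2 : 'rV[R]_n).

Section lebesgue_rV.
Variable R : realType.

Lemma measurable_rV_coord n (i : 'I_n) :
  measurable_fun setT (fun x : borel_rV R n => (x : 'rV[R]_n) ord0 i).
Proof.
apply: (measurability _ (RGenOpens.measurableE R)) => _ [_ [a [b ->]] <-].
rewrite setTI; apply: sub_sigma_algebra.
apply: (@open_comp 'rV[R]_n R (fun x => x ord0 i)).
  by move=> x _; exact: coord_continuous.
exact: interval_open.
Qed.

Lemma measurable_fun_rV d (T : measurableType d) n (f : T -> borel_rV R n) :
  (forall i, measurable_fun setT (fun x => (f x : 'rV[R]_n) ord0 i)) ->
  measurable_fun setT f.
Proof.
move=> mf; apply: (@measurability _ _ T (borel_rV R n) setT f (@open 'rV[R]_n)).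
  by [].
move=> _ [U oU <-].
rewrite setTI.
pose B (qk : 'rV[rat]_n * nat) : set 'rV[R]_n :=
  [set y | forall i, `|y ord0 i - ratr (qk.1 ord0 i)| < qk.2.+1%:R^-1]%R.
pose C qk := if `[< B qk `<=` U >] then f @^-1` B qk else set0.
have -> : f @^-1` U = \bigcup_qk C qk.
  apply/seteqP; split=> [t Ut|t [qk _]]; last first.
    by rewrite /C; case: asboolP => // BU /BU.
  have /nbhs_ballP[e /= e0 xeU] : nbhs (f t : 'rV[R]_n) U.
    exact: open_nbhs_nbhs.
  pose k := Num.truncn (2 / e).
  have ke : (2 * k.+1%:R^-1 < e)%R.
    rewrite ltr_pdivrMr// mulrC -ltr_pdivrMr//; exact: truncnS_gt.
  have /choice[q qx] (i : 'I_n) : exists q : rat,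
      (`|(f t : 'rV[R]_n) ord0 i - ratr q| < k.+1%:R^-1)%R.
    have k0 : (0 < k.+1%:R^-1 :> R)%R by rewrite invr_gt0.
    have /rat_in_itvoo[q] : ((f t : 'rV[R]_n) ord0 i - k.+1%:R^-1 <
       (f t : 'rV[R]_n) ord0 i + k.+1%:R^-1)%R by rewrite ltrD2l gtrN.
    by rewrite in_itv/= => /andP[q1 q2]; exists q; rewrite ltr_distlC q1 q2.
  exists (\row_i q i, k) => //; rewrite /C; case: asboolP => [_|[]].
    by move=> i /=; rewrite mxE; exact: qx.
  move=> y By; apply: xeU; split => // i j; rewrite [i]ord1 /ball/=.
  apply: lt_trans ke; rewrite mulr_natl mulr2n.
  apply: le_lt_trans (ler_distD (ratr (q j)) _ _) _.
  apply: ltrD; first exact: qx.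
  by rewrite distrC; have := By j; rewrite /= mxE.
apply: countable_bigcupT_measurable => [|qk]; first exact: countableP.
rewrite /C; case: asboolP => // _.
rewrite (_ : _ @^-1` _ = \bigcap_(i in [set: 'I_n])
    ((fun x => (f x : 'rV[R]_n) ord0 i) @^-1`
      [set r | `|r - ratr (qk.1 ord0 i)| < qk.2.+1%:R^-1]%R)); last first.
  by apply/seteqP; split=> [t Bt i _|t Bt i]; exact: Bt.
apply: fin_bigcap_measurable => // i _.
rewrite -[X in measurable X]setTI; apply: mf => //.
rewrite [X in measurable X](_ : _ = ball (ratr (qk.1 ord0 i) : R) qk.2.+1%:R^-1%R).
  exact: open_measurable (ball_open _ _).
by apply/seteqP; split=> r /=; rewrite /ball/= distrC.
Qed.

Lemma measurable_cons_rV n : measurable_fun setT (@cons_rV R n).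
Proof.
apply: measurable_fun_rV => i.
case: (split_ordP (i : 'I_(1 + n))) => j ->.
  rewrite (_ : (fun _ => _) = fst)//; apply/funext => p.
  have := row_mxEl (const_mx p.1 : 'rV[R]_1) (p.2 : 'rV[R]_n) ord0 j.
  by rewrite [in RHS]mxE.
rewrite (_ : (fun _ => _) = (fun x : borel_rV R n => (x : 'rV_n) ord0 j) \o snd).
  by apply: measurableT_comp => //; exact: measurable_rV_coord.
apply/funext => p.
exact: (row_mxEr (const_mx p.1 : 'rV[R]_1) (p.2 : 'rV[R]_n) ord0 j).
Qed.

Let uncons_rV n (x : borel_rV R n.+1) : R * borel_rV R n :=
  (lsubmx (x : 'rV[R]_(1 + n)) ord0 ord0, rsubmx (x : 'rV[R]_(1 + n))).

Let measurable_uncons_rV n : measurable_fun setT (@uncons_rV n).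
Proof.
apply: measurable_fun_pair.
  rewrite (_ : (fun _ => _) = fun x : borel_rV R n.+1 =>
    (x : 'rV_(1 + n)) ord0 (lshift n ord0)); first exact: (@measurable_rV_coord n.+1).
  by apply/funext => x; rewrite mxE.
apply: measurable_fun_rV => i.
rewrite (_ : (fun _ => _) = fun x : borel_rV R n.+1 =>
  (x : 'rV_(1 + n)) ord0 (rshift 1 i)); first exact: (@measurable_rV_coord n.+1).
by apply/funext => x; rewrite mxE.
Qed.

Let cons_rVK n : cancel (@cons_rV R n) (@uncons_rV n).
Proof.
by case=> a x; rewrite /uncons_rV /cons_rV row_mxKl row_mxKr mxE.
Qed.

Section step.
Variables (n : nat) (m : sigma_finite_measure (borel_rV R n) R).

Definition cons_measure : set (borel_rV R n.+1) -> \bar R :=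
  pushforward (lebesgue_measure \x m) (@cons_rV R n).

Let step_measure : measure (borel_rV R n.+1) R :=
  measure_function_pushforward__canonical__measure_function_Measure
    (lebesgue_measure \x m) (@measurable_cons_rV n).

Let step_sigma_finite : sigma_finite setT cons_measure.
Proof.
have /sigma_finiteP[F [UF ndF Foo]] := sigma_finiteT (@lebesgue_measure R).
have /sigma_finiteP[G [UG ndG Goo]] := sigma_finiteT m.
exists (fun k => @uncons_rV n @^-1` (F k `*` G k)).
  apply/esym; rewrite -subTset => x _.
  have [i _ Fi] : (\bigcup_i F i) (uncons_rV x).1 by rewrite -UF.
  have [j _ Gj] : (\bigcup_i G i) (uncons_rV x).2 by rewrite -UG.
  exists (maxn i j) => //; split.
    by move: Fi; exact/subsetPset/ndF/leq_maxl.
  by move: Gj; exact/subsetPset/ndG/leq_maxr.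
move=> k; have [mFk Fk] := Foo k; have [mGk Gk] := Goo k; split.
  rewrite -[X in measurable X]setTI; apply: measurable_uncons_rV => //.
  exact: measurableX.
rewrite /cons_measure /pushforward -comp_preimage.
rewrite (_ : _ \o _ = id); last by apply/funext => p; exact: cons_rVK.
rewrite product_measure1E// lte_mul_pinfty//.
by rewrite ge0_fin_numE.
Qed.

HB.instance Definition _ := isMeasure.Build _ _ _ cons_measure
  (@measure0 _ _ _ step_measure) (@measure_ge0 _ _ _ step_measure)
  (@measure_semi_sigma_additive _ _ _ step_measure).
HB.instance Definition _ := Measure_isSigmaFinite.Build _ _ _ cons_measure
  step_sigma_finite.

End step.

Fixpoint lebesgue_rV n : sigma_finite_measure (borel_rV R n) R :=
  match n with
  | 0%N => @dirac _ (borel_rV R 0) (0%R : 'rV[R]_0) R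
  | n.+1 => cons_measure (lebesgue_rV n)
  end.

Lemma lebesgue_rV_box n (A : 'I_n -> set R) : (forall i, measurable (A i)) ->
  lebesgue_rV n [set x : 'rV[R]_n | forall i, A i (x ord0 i)] =
  \prod_(i < n) lebesgue_measure (A i).
Proof.
elim: n A => [|n IHn] A mA.
  by rewrite big_ord0 /= diracE mem_set//; case.
rewrite big_ord_recl -IHn; last by move=> i; exact: mA.
rewrite /= /cons_measure /pushforward.
have mB : measurable
    [set x : borel_rV R n | forall i, A (lift ord0 i) ((x : 'rV_n) ord0 i)].
  rewrite (_ : mkset _ = \bigcap_(i in [set: 'I_n])
      ((fun x : borel_rV R n => (x : 'rV_n) ord0 i) @^-1` A (lift ord0 i))).
    apply: fin_bigcap_measurable => // i _; rewrite -[X in measurable X]setTI.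
    exact: measurable_rV_coord.
  by apply/seteqP; split=> [x Ax i _|x Ax i]; exact: Ax.
rewrite -product_measure1E//; last exact: mA.
congr (product_measure1 _ _ _).
have E0 (p : R * borel_rV R n) : (cons_rV p : 'rV_n.+1) ord0 ord0 = p.1.
  have := row_mxEl (const_mx p.1 : 'rV[R]_1) (p.2 : 'rV[R]_n) ord0 ord0.
  rewrite [in RHS]mxE => <-; congr (_ _ _); exact: val_inj.
have ES (p : R * borel_rV R n) i :
    (cons_rV p : 'rV_n.+1) ord0 (lift ord0 i) = (p.2 : 'rV_n) ord0 i.
  have <- := row_mxEr (const_mx p.1 : 'rV[R]_1) (p.2 : 'rV[R]_n) ord0 i.
  congr (_ _ _); exact: val_inj.
apply/seteqP; split=> [p /= Ap|p /= [Ap1 Ap2] i].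
  by split=> [|i]; [rewrite -E0; exact: Ap|rewrite -ES; exact: Ap].
by case: (unliftP ord0 i) => [j|] ->; rewrite ?ES ?E0.
Qed.

End lebesgue_rV.

Section random_sets.
Context (R : realType) (n : nat).
Local Notation rV := 'rV[R]_n.
Variable XX : set rV.

(* Open, closed and closure relative to [XX], while [interior] is always taken
   in the whole space of row vectors. *)
Definition rel_open (G : set rV) := exists2 U, open U & G = XX `&` U.

Definition rel_closed (F : set rV) := exists2 C, closed C & F = XX `&` C.

Definition rel_closure (A : set rV) : set rV := XX `&` closure A.

Definition hitting (G : set rV) : set (set rV) :=
  [set F | rel_closed F /\ F `&` G !=set0].

(* The sigma-algebra is on the family of relatively closed sets, hence
   complements in it are taken within that family. *)
Definition effros : set (set (set rV)) :=
  <<s rel_closed, [set hitting G | G in rel_open] >>.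

Definition euclidean_norm (y : rV) : R :=
  Num.sqrt (\sum_(i < n) y ord0 i ^+ 2)%R.

(* Adding 0 changes nothing for a nonempty [A] and gives supremum 0 to the empty
   set. *)
Definition sup_norm (A : set rV) : \bar R :=
  ereal_sup (0 |` [set (euclidean_norm y)%:E | y in A]).

Context d (T : measurableType d).

Definition random_set (X : T -> set rV) :=
  (forall w, rel_closed (X w)) /\
  (forall G, rel_open G -> measurable [set w | X w `&` G !=set0]).

Definition independent_random_sets (P : probability T R) (X Y : T -> set rV) :=
  forall A B, effros A -> effros B ->
    P (X @^-1` A `&` Y @^-1` B) = P (X @^-1` A) * P (Y @^-1` B).

Definition integrally_bounded (P : probability T R) (X : T -> set rV) :=
  \int[P]_w sup_norm (X w) < +oo.

(* [Q] is a bare set function because [conditional_nonempty] below carries no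
   measure structure: it does not assume that [Y w !=set0] is an event. *)
Definition coverage (Q : set T -> \bar R) (Y : T -> set rV) (y : rV) : \bar R :=
  \int[Q]_w (\1_(Y w) y)%:E.

Definition total_coverage (Q : set T -> \bar R) (Y : T -> set rV) : \bar R :=
  \int[lebesgue_rV R n]_(y in XX) coverage Q Y y.

(* The quotient is in the extended reals, where [x / 0 = x * +oo]: it is the
   capacity transform pdf only when [total_coverage] is in ]0, +oo[. *)
Definition capacity_pdf (Q : set T -> \bar R) (Y : T -> set rV) (y : rV) :
    \bar R :=
  coverage Q Y y / total_coverage Q Y.

Definition measurement_set m (h : rV -> 'rV[R]_m) (eps : T -> 'rV[R]_m)
    (Z : set 'rV[R]_m) (w : T) : set rV :=
  [set y | XX y /\ Z (h y + eps w)%R].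

Definition empty_prob (P : probability T R) (Y : T -> set rV) : \bar R :=
  1 - \int[P]_w (\1_[set w' | Y w' !=set0] w)%:E.

Definition conditional_nonempty (P : probability T R) (Y : T -> set rV)
    (A : set T) : \bar R :=
  \int[P]_(w in A) ((\1_[set w' | Y w' !=set0] w)%:E / (1 - empty_prob P Y)).

Definition evidence (prior likelihood : rV -> \bar R) : \bar R :=
  \int[lebesgue_rV R n]_(y in XX) (prior y * likelihood y).

Definition bayes_posterior (prior likelihood : rV -> \bar R) (y : rV) :
    \bar R :=
  prior y * likelihood y / evidence prior likelihood.

End random_sets.

(* Main.v *)
Require Import Defs.
From mathcomp Require Import all_boot all_order all_algebra.
From mathcomp Require Import all_classical all_reals all_analysis.
From mathcomp Require Import measurable_realfun ring.

Set Implicit Arguments.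
Unset Strict Implicit.
Unset Printing Implicit Defensive.

Import Order.TTheory GRing.Theory Num.Theory.
Import numFieldNormedType.Exports.

Local Open Scope classical_set_scope.
Local Open Scope ring_scope.
Local Open Scope ereal_scope.

(* By independence P(y in X^a) = P(y in X) L(y) for y in XX, and conditioning on
   X^a being nonempty only divides this by 1 - K, so both sides of Bayes' rule
   are the same function up to normalisation. What has to be justified is that
   the normalising constants are positive: the graph of a random set is product
   measurable, hence by Tonelli the integral of y |-> P(y in X^a) is
   E[lebesgue(X^a)], and by regularity X^a has almost surely positive Lebesgue
   measure whenever it is nonempty. The same equivalence and the completeness
   of P make the nonemptiness of X^a an event. *)

(** * Quotients of extended reals and integrals against set functions *)

Lemma divide_gt0_lty (R : realFieldType) (x y : \bar R) :
  0 < x < +oo -> 0 < y < +oo -> 0 < x / y < +oo.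
Proof.
case: x y => [x||] [y||]//=; rewrite ?ltxx ?andbF// !ltry !andbT !lte_fin.
by move=> x0 y0; rewrite inver gt_eqF// -EFinM lte_fin ltry divr_gt0.
Qed.

(** Both sides reduce to [a * b / i]. In Bayes' rule [p] is the probability of conditioning and [t]
    the prior normalisation; the bounds exclude the conventional values of division at 0 and
    infinity. *)
Lemma divide_cancel (R : realFieldType) (a b i p t : \bar R) :
    a \is a fin_num -> b \is a fin_num ->
    0 < i < +oo -> 0 < p < +oo -> 0 < t < +oo ->
  a * b / p / (i / p) = a / t * b / (i / t).
Proof.
case: a b i p t => [a||]// [b||]// [i||]// [p||]// [t||]// _ _;
  rewrite ?ltxx ?andbF// !ltry !andbT !lte_fin => i0 p0 t0.
rewrite !inver !gt_eqF// -!EFinM !inver !gt_eqF ?divr_gt0// -!EFinM.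
by congr _%:E; field; rewrite !gt_eqF.
Qed.

Import HBNNSimple.

(* [eq_measure_integral] without requiring [m1] and [m2] to be measures. *)
Lemma eq_set_function_integral (R : realType) d (T : measurableType d)
    (m1 m2 : set T -> \bar R) (f : T -> \bar R) :
    (forall A, measurable A -> m1 A = m2 A) ->
  \int[m1]_w f w = \int[m2]_w f w.
Proof.
(* The suprema defining the integral range over simple functions, and these evaluate the set
   function only on measurable level sets. *)
move=> m12; rewrite /integral.
by congr (ereal_sup _ - ereal_sup _); apply: eq_imagel => k _;
  apply: eq_fsbigr => r _; rewrite m12.
Qed.

(** * Open sets and rational points in the space of row vectors *)

Lemma lebesgue_rV_open_gt0 (R : realType) n (U : set 'rV[R]_n) :
  open U -> U !=set0 -> 0 < lebesgue_rV R n U.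
Proof.
move=> oU [x Ux].
have /nbhs_ballP[e /= e0 xeU] : nbhs x U by exact: open_nbhs_nbhs.
pose A i : set R := ball (x ord0 i) e.
have mA i : measurable (A i) by apply: open_measurable; exact: ball_open.
pose B : set (borel_rV R n) := [set y : 'rV[R]_n | forall i, A i (y ord0 i)].
(* Balls of row vectors are for the max norm, hence boxes, and their measure is a product of lengths
   [2 * e] (the empty product 1 if [n] is 0). *)
have BE : B = ball x e.
  apply/seteqP; split=> [y By|y [_ xy] i]; last exact: xy.
  by split => // i j; rewrite [i]ord1; exact: By.
have : 0 < lebesgue_rV R n B.
  rewrite lebesgue_rV_box//; elim/big_ind: _ => // [*|i _]; first exact: mule_gt0.
  by rewrite lebesgue_measure_ball ?ltW// lte_fin mulrn_wgt0.
move=> /lt_le_trans; apply; apply: le_measure; rewrite ?inE.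
- by rewrite BE; apply: sub_sigma_algebra; exact: ball_open.
- exact: sub_sigma_algebra.
- by rewrite BE.
Qed.

Lemma rat_ball_rV (R : realType) n (x : 'rV[R]_n) (e : R) : (0 < e)%R ->
  exists q : 'rV[rat]_n, ball x e (map_mx ratr q : 'rV[R]_n).
Proof.
move=> e0.
have /choice[q qx] (i : 'I_n) : exists q : rat, ball (x ord0 i) e (ratr q : R).
  have /rat_in_itvoo[q] : (x ord0 i - e < x ord0 i + e)%R by rewrite ltrD2l gtrN.
  rewrite in_itv/= => /andP[q1 q2]; exists q.
  by rewrite /ball/= ltr_distlC q1 q2.
exists (\row_i q i); split => // i j; rewrite [i]ord1 !mxE; exact: qx.
Qed.

(** * From hitting events to points: graphs, slices and coverage *)

Section random_set_points.
Context (R : realType) (n : nat).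
Variable XX : set 'rV[R]_n.

Let rat_ball (qk : 'rV[rat]_n * nat) : set 'rV[R]_n :=
  ball (map_mx ratr qk.1 : 'rV[R]_n) qk.2.+1%:R^-1%R.

(** Translates membership into hitting of open sets, the only events that the definitions of random
    set and of [effros] provide. *)
Lemma rel_closed_hitsP (F : set 'rV[R]_n) (y : 'rV[R]_n) :
    rel_closed XX F -> XX y ->
  F y <-> forall U, open U -> U y -> F `&` (XX `&` U) !=set0.
Proof.
move=> [C cC ->] XXy; split=> [[_ Cy] U _ Uy|hitF]; first by exists y.
split => //; rewrite [C](closure_id C).1// => V; rewrite nbhsE => -[U [oU Uy] UV].
have [z [[_ Cz] [_ Uz]]] := hitF _ oU Uy.
by exists z; split => //; exact: UV.
Qed.

(** Countably many test balls, independent of [y], suffice; this is what makes the graph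
    measurable. *)
Lemma rel_closed_rat_ballP (F : set 'rV[R]_n) (y : 'rV[R]_n) :
    rel_closed XX F -> XX y ->
  F y <-> forall qk, rat_ball qk y -> F `&` (XX `&` rat_ball qk) !=set0.
Proof.
move=> cF XXy; rewrite (rel_closed_hitsP cF XXy); split=> hitF.
  by move=> qk By; apply: hitF => //; exact: ball_open.
move=> U oU Uy.
have /nbhs_ballP[e /= e0 yeU] : nbhs y U by exact: open_nbhs_nbhs.
pose k := Num.truncn (2 / e).
(* Two radii must fit in [e]: the rational ball contains [y] but is not centred there, so its points
   are reached through its centre. *)
have ke : (k.+1%:R^-1 + k.+1%:R^-1 < e)%R.
  rewrite -mulr2n -[ltLHS]mulr_natl ltr_pdivrMr// mulrC -ltr_pdivrMr//.
  exact: truncnS_gt.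
have k_gt0 : (0 < k.+1%:R^-1 :> R)%R by rewrite invr_gt0.
have [q /ball_sym yq] := rat_ball_rV y k_gt0.
have [z [Fz [XXz qz]]] := hitF (q, k) yq.
exists z; split => //; split => //; apply: yeU.
exact: le_ball (ltW ke) _ (ball_triangle (ball_sym yq) qz).
Qed.

(** Lets independence be applied at a single point: a closed set contains [y] iff it hits every ball
    of radius [k.+1%:R^-1] around [y]. *)
Lemma effros_mem (y : 'rV[R]_n) : XX y ->
  effros XX [set F | rel_closed XX F /\ F y].
Proof.
move=> XXy.
have [E0 EC EU] : sigma_algebra (rel_closed XX) (effros XX).
  exact: smallest_sigma_algebra.
pose B k : set 'rV[R]_n := ball y k.+1%:R^-1.
(* The countable intersection is written by De Morgan, with complements taken within
   [rel_closed XX], as in the Effros sigma-algebra. *)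
rewrite (_ : mkset _ = rel_closed XX `\`
    \bigcup_k (rel_closed XX `\` hitting XX (XX `&` B k))).
  apply: (EC); apply: (EU) => k; apply: (EC); apply: sub_sigma_algebra.
  by exists (XX `&` B k) => //; exists (B k) => //; exact: ball_open.
apply/seteqP; split=> [F [cF Fy]|F [cF nhit]]; split => //.
  move=> [k _ [_]]; apply; split => //.
  exists y; split => //; split => //; by apply: ballxx; rewrite invr_gt0.
apply/(rel_closed_hitsP cF XXy) => U oU Uy.
have /nbhs_ballP[e /= e0 yeU] : nbhs y U by exact: open_nbhs_nbhs.
have [k ke] := ltr_add_invr e0; rewrite add0r in ke.
apply: contrapT => nFU; apply: nhit; exists k => //; split => // -[_ [z]].
move=> [Fz [XXz Bz]]; apply: nFU; exists z; split => //; split => //.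
apply: yeU; exact: le_ball (ltW ke) _ Bz.
Qed.

Context d (T : measurableType d).

Definition graph (Y : T -> set 'rV[R]_n) : set (T * borel_rV R n) :=
  [set p | Y p.1 p.2].

Lemma xsection_graph Y w : xsection (graph Y) w = Y w.
Proof. by apply/seteqP; split=> y; rewrite /xsection/= inE. Qed.

Lemma ysection_graph Y y : ysection (graph Y) y = [set w | Y w y].
Proof. by apply/seteqP; split=> w; rewrite /ysection/= inE. Qed.

(** A point of [XX] lies outside [Y w] iff some rational ball around it is missed by [Y w], so the
    complement of the graph in [setT] times [XX] is a countable union of measurable rectangles. *)
Lemma measurable_graph (Y : T -> set 'rV[R]_n) :
    measurable (XX : set (borel_rV R n)) -> random_set XX Y ->
  measurable (graph Y).
Proof.
move=> mXX [cY mY].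
pose hit qk := [set w | Y w `&` (XX `&` rat_ball qk) !=set0].
have mhit qk : measurable (hit qk).
  by apply: mY; exists (rat_ball qk) => //; exact: ball_open.
pose miss qk : set (T * borel_rV R n) := ~` hit qk `*` rat_ball qk.
rewrite (_ : graph Y = (setT `*` XX) `\` \bigcup_qk miss qk).
  apply: measurableD; first exact: measurableX.
  apply: countable_bigcupT_measurable => [|qk]; first exact: countableP.
  apply: measurableX; first exact: measurableC.
  by apply: sub_sigma_algebra; exact: ball_open.
have YXX w y : Y w y -> XX y by have [C _ ->] := cY w; case.
apply/seteqP; split=> [[w y] /= Ywy|[w y] /= [[_ XXy] nmiss]].
  have XXy := YXX _ _ Ywy; split => // -[qk _ [/= + By]]; apply.
  exact: (rel_closed_rat_ballP (cY w) XXy).1.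
apply/(rel_closed_rat_ballP (cY w) XXy) => qk By.
by apply: contrapT => nhit; apply: nmiss; exists qk.
Qed.

Lemma coverageE (P : {measure set T -> \bar R}) (Y : T -> set 'rV[R]_n) y :
  measurable [set w | Y w y] -> coverage P Y y = P [set w | Y w y].
Proof.
by move=> mY; rewrite -[in RHS](setIT [set w | Y w y]) -integral_indic.
Qed.

Lemma measurable_slice (Y : T -> set 'rV[R]_n) y :
  measurable (graph Y) -> measurable [set w | Y w y].
Proof. by move=> mY; rewrite -ysection_graph; exact: measurable_ysection. Qed.

Lemma measurable_coverage (P : probability T R) (Y : T -> set 'rV[R]_n) :
  measurable (graph Y) ->
  measurable_fun setT (coverage P Y : borel_rV R n -> \bar R).
Proof.
move=> mY; rewrite (_ : coverage P Y = P \o ysection (graph Y)).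
  exact: measurable_fun_ysection.
apply/funext => y; rewrite /= ysection_graph coverageE//.
exact: measurable_slice.
Qed.

(* Robbins' formula, by Tonelli's theorem. *)
Lemma total_coverageE (P : probability T R) (Y : T -> set 'rV[R]_n) :
    (forall w, Y w `<=` XX) -> measurable (graph Y) ->
  total_coverage XX P Y = \int[P]_w lebesgue_rV R n (Y w).
Proof.
move=> YXX mY.
have := indic_fubini_tonelli P (lebesgue_rV R n) mY.
rewrite indic_fubini_tonelli_FE// indic_fubini_tonelli_GE// => tonelli.
transitivity (\int[P]_w (lebesgue_rV R n \o xsection (graph Y)) w); last first.
  by apply: eq_integral => w _ /=; rewrite xsection_graph.
rewrite tonelli /total_coverage integral_mkcond; apply: eq_integral => y _.
rewrite patchE /= ysection_graph -coverageE; last exact: measurable_slice.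
(* Tonelli integrates over the whole space; outside [XX] the slice is empty and contributes 0. *)
case: ifPn => //; rewrite notin_setE => nXXy.
rewrite coverageE; last exact: measurable_slice.
by rewrite (_ : mkset _ = set0) ?measure0// -subset0 => w /YXX.
Qed.

End random_set_points.

(** * Regularity, independence and conditioning on nonemptiness *)

Section posterior.
Context (R : realType) (n : nat) d (T : measurableType d).
Context (P : probability T R) (XX : set 'rV[R]_n).
Implicit Types Y : T -> set 'rV[R]_n.

Lemma ae_nonempty_lebesgue_gt0 Y : measurable (graph Y) ->
    {ae P, forall w, Y w = rel_closure XX (interior (Y w))} ->
  {ae P, forall w, Y w !=set0 -> 0 < lebesgue_rV R n (Y w)}.
Proof.
move=> mY; apply: filterS => w Yw [y]; rewrite Yw => -[_ clYy].
(* A point in the closure of the interior forces the interior to be nonempty: test the closure with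
   the whole space. *)
have [z [intYz _]] := clYy setT filterT; rewrite -Yw.
have := lebesgue_rV_open_gt0 (@open_interior _ (Y w)) (ex_intro _ z intYz).
move/lt_le_trans; apply; apply: le_measure; rewrite ?inE.
- by apply: sub_sigma_algebra; exact: open_interior.
- by rewrite -(xsection_graph Y w); exact: measurable_xsection.
- exact: interior_subset.
Qed.

Let pos Y := [set w | 0 < lebesgue_rV R n (Y w)].

Let measurable_pos Y : measurable (graph Y) -> measurable (pos Y).
Proof.
move=> mY.
rewrite (_ : pos Y = setT `&` [set w |
    cst 0 w < (lebesgue_rV R n \o xsection (graph Y)) w]).
  by apply: emeasurable_fun_lt => //; exact: measurable_fun_xsection.
by rewrite setTI; apply/seteqP; split=> w; rewrite /pos /= xsection_graph.
Qed.

(** Nonempty values of measure zero occur only on a negligible set, an event by completeness; all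
    other nonempty values form the event [pos Y]. *)
Lemma measurable_nonempty Y : measure_is_complete P ->
    measurable (graph Y) ->
    {ae P, forall w, Y w = rel_closure XX (interior (Y w))} ->
  measurable [set w | Y w !=set0].
Proof.
move=> Pcomplete mY Yreg.
have neg := ae_nonempty_lebesgue_gt0 mY Yreg.
rewrite (_ : mkset _ =
    pos Y `|` ~` [set w | Y w !=set0 -> 0 < lebesgue_rV R n (Y w)]).
  by apply: measurableU; [exact: measurable_pos|exact: Pcomplete].
apply/seteqP; split=> [w Yw|w [posw|/not_implyP[]//]].
  have [?|?] := pselect (0 < lebesgue_rV R n (Y w)); [by left|].
  by right => /(_ Yw).
apply/set0P; apply: contraTneq posw => Yw0.
by rewrite Yw0 measure0 ltxx.
Qed.

(** If the expected volume vanished, the volume would be almost surely 0, so by regularity [Y] would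
    be almost surely empty. *)
Lemma total_coverage_gt0 Y : (forall w, Y w `<=` XX) ->
    measurable (graph Y) ->
    {ae P, forall w, Y w = rel_closure XX (interior (Y w))} ->
    measurable [set w | Y w !=set0] -> 0 < P [set w | Y w !=set0] ->
  0 < total_coverage XX P Y.
Proof.
move=> YXX mY Yreg mne Pne; rewrite total_coverageE// lt_neqAle.
rewrite integral_ge0 ?andbT// eq_sym; apply/eqP => lY0.
move: Pne; apply/negP; rewrite -leNgt measure_le0; apply/eqP.
apply: measure_negligible => //.
have mlY : measurable_fun setT (fun w => lebesgue_rV R n (Y w)).
  rewrite (_ : (fun _ => _) = lebesgue_rV R n \o xsection (graph Y)).
    exact: measurable_fun_xsection.
  by apply/funext => w /=; rewrite xsection_graph.
have /(ae_eq_integral_abs P measurableT mlY) lYae :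
    \int[P]_w `|lebesgue_rV R n (Y w)| = 0.
  by rewrite -lY0; apply: eq_integral => w _; rewrite gee0_abs.
have [N [mN PN0 subN]] : {ae P, forall w, ~ (Y w !=set0)}.
  have := ae_nonempty_lebesgue_gt0 mY Yreg.
  by move: lYae; apply: filterS2 => w /(_ I) /= -> /[apply]; rewrite ltxx.
by exists N; split => // w Yw; apply: subN => /(_ Yw).
Qed.

Lemma coverage_setI_independent (Y1 Y2 : T -> set 'rV[R]_n) y :
    (forall w, rel_closed XX (Y1 w)) -> (forall w, rel_closed XX (Y2 w)) ->
    measurable (graph Y1) -> measurable (graph Y2) ->
    independent_random_sets XX P Y1 Y2 -> XX y ->
  coverage P (fun w => Y1 w `&` Y2 w) y = coverage P Y1 y * coverage P Y2 y.
Proof.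
move=> c1 c2 m1 m2 indep XXy.
have mem Y : (forall w, rel_closed XX (Y w)) ->
    Y @^-1` [set F | rel_closed XX F /\ F y] = [set w | Y w y].
  by move=> cY; apply/seteqP; split=> [w [_]//|w Ywy]; split.
have := indep _ _ (effros_mem XXy) (effros_mem XXy).
rewrite !mem// => indepy.
rewrite !coverageE//; [exact: measurable_slice..|].
by apply: measurableI; exact: measurable_slice.
Qed.

Lemma conditional_nonemptyE Y A : measurable [set w | Y w !=set0] ->
    measurable A ->
  conditional_nonempty P Y A =
  P (A `&` [set w | Y w !=set0]) / P [set w | Y w !=set0].
Proof.
move=> mne mA; rewrite /conditional_nonempty /empty_prob.
rewrite integral_indic// setIT.
have -> : 1 - (1 - P [set w | Y w !=set0]) = P [set w | Y w !=set0].
  have /fineK <- : P [set w | Y w !=set0] \is a fin_num by exact: fin_num_measure.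
  by rewrite -!EFinB opprB addrCA subrr addr0.
rewrite ge0_integralZr//.
- by rewrite integral_indic// setIC.
- by apply/measurable_EFinP; exact: measurable_indic.
- by rewrite inve_ge0.
Qed.

Lemma coverage_conditional_nonempty Y y : measurable (graph Y) ->
    measurable [set w | Y w !=set0] -> 0 < P [set w | Y w !=set0] ->
  coverage (conditional_nonempty P Y) Y y =
  coverage P Y y / P [set w | Y w !=set0].
Proof.
move=> mY mne Pne; set p := P _.
have pfin : p \is a fin_num by exact: fin_num_measure.
have pr : (0 < fine p)%R by rewrite -lte_fin fineK.
have pV0 : (0 <= (fine p)^-1)%R by rewrite invr_ge0 ltW.
pose k : {nonneg R} := NngNum pV0.
have kE : k%:num%:E = p^-1 by rewrite -[in RHS](fineK pfin) inver gt_eqF.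
(* Replaces the bare set function by a genuine measure agreeing with it on measurable sets, so that
   [coverageE] applies. *)
transitivity (coverage (mscale k (mrestr P mne)) Y y).
  apply: eq_set_function_integral => A mA.
  by rewrite conditional_nonemptyE// /mscale/= /mrestr kE muleC.
have mYy := measurable_slice y mY.
rewrite !coverageE// -kE [RHS]muleC; congr (_ * P _).
(* Covering [y] already implies nonemptiness, so the restriction is invisible here. *)
by apply/seteqP; split=> [w []//|w Ywy]; split => //; exists y.
Qed.

End posterior.

(** * Bayes' rule by comparing normalising constants *)

Theorem theorem2 (R : realType) (d : measure_display) (T : measurableType d)
    (P : probability T R) (n m : nat) (XX : set 'rV[R]_n)
    (X : T -> set 'rV[R]_n) (h : 'rV[R]_n -> 'rV[R]_m)
    (eps : {RV P >-> borel_rV R m}) (Z : set 'rV[R]_m) :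
  let Xd : T -> set 'rV[R]_n := measurement_set XX h eps Z in
  let Xa : T -> set 'rV[R]_n := fun w => X w `&` Xd w in
  let K : \bar R := empty_prob P Xa in
  let Pa : set T -> \bar R := conditional_nonempty P Xa in
  let piT : 'rV[R]_n -> \bar R := capacity_pdf XX P X in
  let piTa : 'rV[R]_n -> \bar R := capacity_pdf XX Pa Xa in
  let L : 'rV[R]_n -> \bar R := coverage P Xd in
  measure_is_complete P ->
  measurable (XX : set (borel_rV R n)) ->
  random_set XX X ->
  random_set XX Xd ->
  integrally_bounded P X ->
  integrally_bounded P Xd ->
  independent_random_sets XX P X Xd ->
  0 < total_coverage XX P X < +oo ->
  K < 1 ->
  {ae P, forall w, X w = rel_closure XX (interior (X w))} ->
  {ae P, forall w, Xd w = rel_closure XX (interior (Xd w))} ->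
  {ae P, forall w, Xa w = rel_closure XX (interior (Xa w))} ->
  [/\ 0 < total_coverage XX Pa Xa < +oo,
      0 < evidence XX piT L < +oo
    & forall y, XX y -> piTa y = bayes_posterior XX piT L y].
Proof.
move=> Xd Xa K Pa piT piTa L Pcomplete mXX rX rXd _ _ indep /andP[t0 too] K1
  _ _ Xareg.
have mX : measurable (graph X) := measurable_graph mXX rX.
have mXd : measurable (graph Xd) := measurable_graph mXX rXd.
(* The graph of an intersection is the intersection of the graphs. *)
have mXa : measurable (graph Xa) by exact: measurableI.
have mne : measurable [set w | Xa w !=set0].
  exact: measurable_nonempty Pcomplete mXa Xareg.
have XaXX w : Xa w `<=` XX by move=> y [_ []].
set c := coverage P X.
have covXa y : XX y -> coverage P Xa y = c y * L y.
  by apply: coverage_setI_independent => // w; [exact: rX.1|exact: rXd.1].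
set p := P [set w | Xa w !=set0].
have pfin : p \is a fin_num by exact: fin_num_measure.
(* [K] is [1 - p]. *)
have p0 : 0 < p.
  have : 1 - p < 1 by move: K1; rewrite /K /empty_prob integral_indic// setIT.
  by rewrite -(fineK pfin) -EFinB !lte_fin gtrBl.
have covPa y : coverage Pa Xa y = coverage P Xa y / p.
  exact: coverage_conditional_nonempty.
set t := total_coverage XX P X in t0 too *.
pose i := total_coverage XX P Xa.
have i0 : 0 < i by exact: total_coverage_gt0.
have mcov Y : measurable (graph Y) ->
    measurable_fun (XX : set (borel_rV R n)) (coverage P Y).
  by move=> mY; apply: measurable_funTS; exact: measurable_coverage.
have cov_ge0 Y y : 0 <= coverage P Y y.
  by apply: integral_ge0 => w _; rewrite lee_fin.
(* [Xa w] is contained in [X w], so [i] is at most [t]. *)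
have ioo : i < +oo.
  apply: le_lt_trans too; apply: ge0_le_integral => //; [exact: mcov..|].
  move=> y _; rewrite !coverageE; [|exact: measurable_slice..].
  by apply: le_measure; rewrite ?inE; [exact: measurable_slice..|move=> w []].
(* Both normalising constants are multiples of the same integral [i], by [1 / p] for the posterior
   set and by [1 / t] for the evidence. *)
have totPa : total_coverage XX Pa Xa = i / p.
  rewrite -ge0_integralZr//; [|exact: mcov|by rewrite inve_ge0 ltW].
  by apply: eq_integral => y _; exact: covPa.
have evE : evidence XX piT L = i / t.
  rewrite -ge0_integralZr//; [|exact: mcov|by rewrite inve_ge0 ltW].
  by apply: eq_integral => y; rewrite inE => XXy; rewrite covXa// muleAC.
have i_bnd : 0 < i < +oo by rewrite i0.
have p_bnd : 0 < p < +oo by rewrite p0 -ge0_fin_numE// ltW.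
have t_bnd : 0 < t < +oo by rewrite t0.
rewrite /piTa /bayes_posterior /piT /capacity_pdf -/c -/t totPa evE.
split; [exact: divide_gt0_lty..|move=> y XXy].
have covfin Y : measurable (graph Y) -> coverage P Y y \is a fin_num.
  move=> mY; rewrite coverageE; last exact: measurable_slice.
  by apply: fin_num_measure; exact: measurable_slice.
by rewrite covPa covXa//; apply: divide_cancel => //; exact: covfin.
Qed.
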